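(* Consider the tandem speed-scaling problem described in the context, with unit-size jobs and an identical power function $P$ at all $K$ servers. For every finite input (every number $n$ of jobs and every sequence of arrival times) the cost of the online algorithm described in the context is at most $\left(6+\frac{12}{P'(s^\star)}\Delta(1)\right)$ times the cost of the optimal offline schedule, where $\Delta(1)=P'(P^{-1}(1))$ and $s^\star>0$ satisfies $1+P(s^\star)=s^\star P'(s^\star)$. In particular, for $P(s)=s^\alpha$ one has $\Delta(1)=\alpha$, and for $P(s)=s^2$ the competitive ratio is at most $18$.
   Context: There are $K$ servers in tandem (series), each with an unbounded buffer. Jobs $j=1,\dots,n$ arrive at server $1$ at arbitrary (possibly adversarial) times $a_j$; every job has size (work) $1$ at every server and must be processed by servers $1,2,\dots,K$ in this order: server $k$ may process a job only after it has been completely processed by server $k-1$. A server running at speed $s$ processes work at rate $s$ and consumes power $P(s)$, where $P:[0,\infty)\to[0,\infty)$ is strictly increasing, strictly convex and differentiable, with $P^{-1}$ defined on $[0,\infty)$. If $n(t)$ is the number of jobs not yet completed at server $K$ at time $t$ and $s_k(t)$ the speed of server $k$, the cost of a schedule is $C=\int n(t)\,dt+\int\sum_{k=1}^K P(s_k(t))\,dt$. The optimal offline schedule knows all arrival times in advance and minimizes $C$; the competitive ratio of an online algorithm (which knows job $j$ only from time $a_j$) is the supremum over inputs of its cost divided by the optimal offline cost. The online algorithm: let $n^1(t)$ be the number of outstanding jobs at server $1$, and $A(t)$ the number of servers $i\ge2$ that have an unfinished job (active servers). Server $1$ runs at speed $P^{-1}\!\left(\frac{n^1(t)+A(t)+1}{A(t)+1}\right)$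 if $n^1(t)>0$ and speed $0$ otherwise. Each active server $i\ge 2$ runs at speed $P^{-1}\!\left(\frac{n^1(t)+A(t)+1}{A(t)+1}\right)$ if $n^1(t)>0$ and at speed $P^{-1}(2)$ if $n^1(t)=0$; inactive servers run at speed $0$. *)

(* Defs.v *)
From HB Require Import structures.
From mathcomp Require Import all_boot all_order all_algebra.
From mathcomp Require Import all_classical all_reals all_analysis.
Set Implicit Arguments.
Unset Strict Implicit.
Unset Printing Implicit Defensive.
Import Order.TTheory GRing.Theory Num.Theory.
Import numFieldNormedType.Exports.
Local Open Scope classical_set_scope.
Local Open Scope ring_scope.

(* Only the values of P and Pinv on [0, +oo[ matter. At 0, differentiability is
   the existence of the right derivative. Pinv is the inverse of P: P is
   injective on [0, +oo[ by monotonicity, so pf_inv_ge0 and pf_invK determine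
   Pinv on [0, +oo[ (and force P 0 = 0). *)
Record power_function (R : realType) (P Pinv : R -> R) : Prop := PowerFunction {
  pf_ge0 : forall s : R, 0 <= s -> 0 <= P s;
  pf_increasing : forall s t : R, 0 <= s -> s < t -> P s < P t;
  pf_strictly_convex : forall s t l : R, 0 <= s -> 0 <= t -> s != t ->
    0 < l -> l < 1 -> P (l * s + (1 - l) * t) < l * P s + (1 - l) * P t;
  pf_derivable : forall s : R, 0 < s -> derivable P s 1;
  pf_derivable0 : cvg ((fun h => h^-1 * (P h - P 0)) h @[h --> 0^'+]);
  pf_inv_ge0 : forall x : R, 0 <= x -> 0 <= Pinv x;
  pf_invK : forall x : R, 0 <= x -> P (Pinv x) = x }.

Definition Delta (R : realType) (P Pinv : R -> R) (x : R) : R := derive1 P (Pinv x).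

(* [r k j t] is the rate at which server [k] processes job [j] at time [t];
   servers are numbered from 0, so that the first server is [k = 0]. *)
Definition schedule (R : realType) (K n : nat) := 'I_K -> 'I_n -> R -> R.

Section Tandem.
Variables (R : realType) (K n : nat).
Implicit Types (a : 'I_n -> R) (r : schedule R K n) (k : 'I_K) (j : 'I_n) (t : R).

Definition speed r k t : R := \sum_(j < n) r k j t.

Definition work r k j t : \bar R :=
  (\int[lebesgue_measure]_(u in [set` `]-oo, t]]) (r k j u)%:E)%E.

(* Job [j] has been completed at the server preceding position [m]; vacuously
   true for [m = 0], and completion at the last server for [m = K]. *)
Definition completed_before r (m : nat) j t : bool :=
  [forall i : 'I_K, (i.+1 == m) ==> (1%:E <= work r i j t)%E].

Definition available a r k j t : bool :=
  (a j <= t) && completed_before r k j t.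

Definition outstanding a r k j t : bool :=
  available a r k j t && (work r k j t < 1%:E)%E.

(* A server may be switched between jobs, or shared by several jobs, at will. *)
Record feasible a r : Prop := Feasible {
  fs_measurable : forall k j, measurable_fun [set: R] (r k j);
  fs_ge0 : forall k j t, 0 <= r k j t;
  fs_work_le1 : forall k j t, (work r k j t <= 1%:E)%E;
  fs_available : forall k j t, 0 < r k j t -> available a r k j t }.

(* Number of jobs in the system: arrived, not yet completed at the last server. *)
Definition njobs a r t : nat :=
  #|[set j : 'I_n | (a j <= t) && ~~ completed_before r K j t]%SET|.

Definition cost (P : R -> R) a r : \bar R :=
  (\int[lebesgue_measure]_(t in [set: R]) ((njobs a r t)%:R)%:E
   + \int[lebesgue_measure]_(t in [set: R]) (\sum_(k < K) P (speed r k t))%:E)%E.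

(* Jobs that are never completed make the cost +oo. *)
Definition opt_cost (P : R -> R) a : \bar R :=
  ereal_inf [set cost P a r | r in [set r | feasible a r]].

Definition queue a r k t : nat := #|[set j : 'I_n | outstanding a r k j t]%SET|.

(* The sum has the single term [k = 0]. *)
Definition queue1 a r t : nat := (\sum_(k < K | k == 0 :> nat) queue a r k t)%N.

Definition nactive a r t : nat :=
  #|[set k : 'I_K | (0 < k)%N && (0 < queue a r k t)%N]%SET|.

Definition online_speed (Pinv : R -> R) a r k t : R :=
  let q := (queue1 a r t + nactive a r t + 1)%:R / (nactive a r t + 1)%:R in
  if k == 0%N :> nat then
    if (0 < queue1 a r t)%N then Pinv q else 0
  else if (0 < queue a r k t)%N then
    if (0 < queue1 a r t)%N then Pinv q else Pinv 2
  else 0.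

(* [r] is the run of the online algorithm on the input [a]. The algorithm
   prescribes the speeds only; a server serves one job at a time, to
   completion, in any order. The jobs having equal sizes, this includes
   first-come first-served and all these orders give the same speeds. *)
Record online a (Pinv : R -> R) r : Prop := Online {
  on_feasible : feasible a r;
  on_speed : forall k t, speed r k t = online_speed Pinv a r k t;
  on_nonpreemptive : forall k j t,
    (0 < work r k j t)%E -> (work r k j t < 1%:E)%E -> r k j t = speed r k t }.

End Tandem.

Definition competitive_ratio (R : realType) (K : nat) (P Pinv : R -> R) : \bar R :=
  ereal_sup [set x | exists (n : nat) (a : 'I_n -> R) (r : schedule R K n),
    [/\ (0 < n)%N, online a Pinv r & x = (cost P a r / opt_cost K P a)%E]].

(* Main.v *)
Require Import Defs.
From HB Require Import structures.
From mathcomp Require Import all_boot all_order all_algebra.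
From mathcomp Require Import all_classical all_reals all_analysis.
From mathcomp Require Import measurable_realfun ring lra zify.
Set Implicit Arguments.
Unset Strict Implicit.
Unset Printing Implicit Defensive.
Import Order.TTheory GRing.Theory Num.Theory.
Import numFieldNormedType.Exports.
Local Open Scope classical_set_scope.
Local Open Scope ring_scope.

(* All active servers of the online algorithm run at the same speed, so every
   server but the first has at most one outstanding job. Hence, with n1 the queue
   of the first server and A the number of other active servers, the cost rate is
   at most 2 n1 + 3 (A + 1[n1 > 0]), and since the active servers run at speed at
   least s1 = Pinv 1, the second term costs at most 3 n K / s1 <= 3 n K Delta(1)
   in total. For n1, compare the work S done by the first server with the average
   work W / K done per server by a competitor with n' jobs in the system: the lag
   D = W / K - S satisfies D <= n1 <= n' + D + 1, and the first server runs at
   speed at least Pinv (1 + n1 / K). A convex potential of D with slope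
   K P'(Pinv (D / K)) then bounds the integral of n1 by the cost of the competitor
   plus 3 n / s1. Finally every schedule costs at least n K P'(sstar), because
   P'(sstar) x <= 1 + P x for all speeds x, with equality at sstar. *)

(** * Power functions *)

Section PowerFunction.
Context {R : realType} {P Pinv : R -> R} (pf : power_function P Pinv).
Implicit Types s t x y : R.

(** [Pinv 0] is a zero of [P]; were it positive, strict monotonicity would make [P 0] negative. *)
Lemma power0 : P 0 = 0.
Proof.
have Pinv0 := pf_invK pf (lexx 0).
have := pf_inv_ge0 pf (lexx 0); rewrite le_eqVlt => /predU1P[e|lt0].
  by rewrite [X in P X]e.
have := pf_increasing pf (lexx 0) lt0.
by rewrite Pinv0 ltNge (pf_ge0 pf).
Qed.

Lemma power_le s t : 0 <= s -> s <= t -> P s <= P t.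
Proof.
by move=> s0; rewrite le_eqVlt => /predU1P[->//|st]; exact/ltW/(pf_increasing pf).
Qed.

Lemma power_le_inv s t : 0 <= t -> P s <= P t -> s <= t.
Proof.
move=> t0 /le_gtF st; rewrite leNgt; apply/negP => /(pf_increasing pf t0).
by rewrite st.
Qed.

Lemma powerK s : 0 <= s -> Pinv (P s) = s.
Proof.
move=> s0; have Ps0 := pf_ge0 pf s0.
by apply/le_anti/andP; split; apply: power_le_inv;
  rewrite ?(pf_inv_ge0 pf)// (pf_invK pf).
Qed.

Lemma Pinv_le x y : 0 <= x -> x <= y -> Pinv x <= Pinv y.
Proof.
move=> x0 xy; have y0 := le_trans x0 xy.
by apply: power_le_inv; rewrite ?(pf_inv_ge0 pf)// !(pf_invK pf).
Qed.

Lemma Pinv_gt0 x : 0 < x -> 0 < Pinv x.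
Proof.
move=> x0; rewrite lt_neqAle (pf_inv_ge0 pf (ltW x0)) andbT eq_sym.
apply/eqP => e; have := pf_invK pf (ltW x0).
by rewrite e power0 => x00; rewrite -x00 ltxx in x0.
Qed.

(** By convexity, for [0 < h < 1] the difference quotient of [P] from [s] towards [t] is at most
    [P t - P s]; as [h] tends to 0 it converges to the derivative at [s] in the direction
    [t - s]. *)
Lemma power_tangent s t : 0 < s -> 0 <= t ->
  P s + derive1 P s * (t - s) <= P t.
Proof.
move=> s0 t0.
have [->|ts] := eqVneq t s; first by rewrite subrr mulr0 addr0.
have dP := pf_derivable pf s0.
have difP : differentiable P s by apply/derivable1_diffP.
have -> : derive1 P s * (t - s) = 'D_(t - s) P s.
  rewrite derive1E !deriveE//.
  by rewrite -[X in _ = 'd P s X]mulr1 -[X in _ = 'd P s X]/((t - s) *: (1 : R)) linearZ/= mulrC.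
have /= cvP := @diff_derivable _ _ _ _ _ (t - s) difP.
(* Convexity controls the quotient for positive [h] only, so the two-sided limit is restricted to
   the right. *)
have cvR : h^-1 *: (P (h *: (t - s) + s) - P s) @[h --> 0^'+] --> 'D_(t - s) P s.
  apply: cvg_trans cvP; apply: cvg_app => A [e/= e0 eA].
  by exists e => //= y ye y0; apply: eA => //; rewrite gt_eqF.
rewrite addrC -lerBrDr.
apply: (cvgr_to_le cvR).
near=> h.
have h0 : 0 < h by near: h; exact: nbhs_right_gt.
have h1 : h < 1 by near: h; exact: nbhs_right_lt.
rewrite /GRing.scale/= mulrC ler_pdivrMr//.
have := pf_strictly_convex pf t0 (ltW s0) ts h0 h1.
have -> : h * (t - s) + s = h * t + (1 - h) * s by ring.
lra.
Unshelve. all: by end_near. Qed.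

Lemma derive_power_ge s : 0 < s -> P s <= s * derive1 P s.
Proof.
by move=> s0; have := power_tangent s0 (lexx 0); rewrite power0; lra.
Qed.

Lemma derive_power_gt0 s : 0 < s -> 0 < derive1 P s.
Proof.
move=> s0; rewrite -(pmulr_rgt0 _ s0); apply: lt_le_trans (derive_power_ge s0).
by rewrite -power0; exact: (pf_increasing pf).
Qed.

(** Add the tangent inequality at [s] evaluated at [t] to the one at [t] evaluated at [s]. *)
Lemma derive_power_le s t : 0 < s -> s <= t -> derive1 P s <= derive1 P t.
Proof.
move=> s0; rewrite le_eqVlt => /predU1P[->//|st].
have t0 := lt_trans s0 st.
have := power_tangent s0 (ltW t0); have := power_tangent t0 (ltW s0).
move=> h1 h2; rewrite -subr_ge0 -(pmulr_lge0 _ (_ : 0 < t - s)) ?subr_gt0//.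
lra.
Qed.

End PowerFunction.

(** * Cumulative integrals of nonnegative integrable functions *)

Section RealIntegrals.
Context {R : realType}.
Local Notation mu := (@lebesgue_measure R).
Implicit Types (f g : R -> R) (c : R).

Lemma integralZ_ge0 c f : 0 <= c -> measurable_fun setT f ->
  (forall t, 0 <= f t) ->
  (\int[mu]_t (c * f t)%:E = c%:E * \int[mu]_t (f t)%:E)%E.
Proof.
move=> c0 mf f0; under eq_integral do rewrite EFinM.
apply: ge0_integralZl_EFin => //; first by move=> t _; rewrite lee_fin.
exact/measurable_EFinP.
Qed.

Lemma integralD_ge0 f g : measurable_fun setT f -> (forall t, 0 <= f t) ->
  measurable_fun setT g -> (forall t, 0 <= g t) ->
  (\int[mu]_t (f t + g t)%:E = \int[mu]_t (f t)%:E + \int[mu]_t (g t)%:E)%E.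
Proof.
move=> mf f0 mg g0; under eq_integral do rewrite EFinD.
apply: ge0_integralD => //.
- by move=> t _; rewrite lee_fin.
- exact/measurable_EFinP.
- by move=> t _; rewrite lee_fin.
- exact/measurable_EFinP.
Qed.

Lemma integral_le_ge0 f g : measurable_fun setT f -> measurable_fun setT g ->
  (forall t, 0 <= f t) -> (forall t, f t <= g t) ->
  (\int[mu]_t (f t)%:E <= \int[mu]_t (g t)%:E)%E.
Proof.
move=> mf mg f0 fg; apply: ge0_le_integral => //.
- by move=> t _; rewrite lee_fin.
- exact/measurable_EFinP.
- exact/measurable_EFinP.
- by move=> t _; rewrite lee_fin.
Qed.

End RealIntegrals.

Section Cumulative.
Context {R : realType}.
Local Notation mu := (@lebesgue_measure R).
Implicit Types (f g : R -> R) (t u : R).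

(** Monotone convergence along the half-lines up to the naturals. *)
Lemma ge0_integral_le_upto f (M : \bar R) : measurable_fun setT f ->
  (forall t, 0 <= f t) ->
  (forall t, (\int[mu]_(u in [set` `]-oo, t]]) (f u)%:E <= M)%E) ->
  (\int[mu]_(u in setT) (f u)%:E <= M)%E.
Proof.
move=> mf f0 fM.
have -> : [set: R] = \bigcup_(i : nat) [set` `]-oo, i%:R : R]].
  apply/esym; rewrite -subTset => x _ /=.
  have [k xk] : exists k : nat, x < k%:R.
    by exists (Num.bound `|x|); rewrite (le_lt_trans (ler_norm x))// archi_boundP.
  by exists k => //=; rewrite in_itv/= ltW.
have cv : (\int[mu]_(u in [set` `]-oo, i%:R : R]]) (f u)%:E)%E @[i --> \oo] -->
    (\int[mu]_(u in \bigcup_(i : nat) [set` `]-oo, i%:R : R]]) (f u)%:E)%E.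
  apply: ge0_nondecreasing_set_cvg_integral.
  - move=> a b ab; rewrite subsetEset; apply: subset_itvl.
    by rewrite bnd_simp ler_nat.
  - by move=> i; exact: measurable_itv.
  - by move=> i; apply/measurable_EFinP; exact: measurable_funTS.
  - by move=> i x _; rewrite lee_fin.
by apply: (cvge_to_le cv); apply: nearW => i; exact: fM.
Qed.

Record nn_integrable f : Prop := NNIntegrable {
  nni_measurable : measurable_fun setT f ;
  nni_ge0 : forall t, 0 <= f t ;
  nni_fin : (\int[mu]_(u in setT) (f u)%:E < +oo)%E }.

(** Real-valued, so that work can be subtracted; [fine] loses nothing for a function satisfying
    [nn_integrable]. *)
Definition cumul f t : R := fine (\int[mu]_(u in [set` `]-oo, t]]) (f u)%:E).

Section OneFunction.
Variable f : R -> R.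
Hypothesis nnf : nn_integrable f.
Let mf := nni_measurable nnf.
Let f0 := nni_ge0 nnf.

Lemma nni_measurable_EFin (D : set R) : measurable_fun D (fun u => (f u)%:E).
Proof. by apply/measurable_EFinP; exact: measurable_funTS. Qed.

Lemma nni_integrable (D : set R) : measurable D ->
  mu.-integrable D (fun u => (f u)%:E).
Proof.
move=> mD; apply: (@integrableS _ _ _ _ setT) => //.
apply/integrableP; split; first exact: nni_measurable_EFin.
under eq_integral => x _ do rewrite gee0_abs ?lee_fin//.
exact: nni_fin.
Qed.

Lemma cumulE t : (\int[mu]_(u in [set` `]-oo, t]]) (f u)%:E)%E = (cumul f t)%:E.
Proof.
rewrite /cumul fineK//; apply: integrable_fin_num; first exact: measurable_itv.
by apply: nni_integrable; exact: measurable_itv.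
Qed.

Lemma cumul_ge0 t : 0 <= cumul f t.
Proof. by rewrite -lee_fin -cumulE; apply: integral_ge0 => x _; rewrite lee_fin. Qed.

Lemma cumulB t t' : t <= t' ->
  (\int[mu]_(u in [set` `]t, t']]) (f u)%:E)%E = (cumul f t' - cumul f t)%:E.
Proof.
move=> tt'; rewrite EFinB -!cumulE.
have -> : [set` `]-oo, t']] = [set` `]-oo, t]] `|` [set` `]t, t']] :> set R.
  by apply: itv_bndbnd_setU; rewrite bnd_simp.
rewrite ge0_integral_setU;
  [|exact: measurable_itv|exact: measurable_itv|exact: nni_measurable_EFin| |].
- by rewrite cumulE addeAC subee ?add0e.
- by move=> x _; rewrite lee_fin.
- by apply/disj_setPS => x/= []; rewrite !in_itv/= => xt /andP[]; rewrite ltNge xt.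
Qed.

Lemma cumul_le t t' : t <= t' -> cumul f t <= cumul f t'.
Proof.
move=> tt'; rewrite -subr_ge0 -lee_fin -cumulB//.
by apply: integral_ge0 => x _; rewrite lee_fin.
Qed.

(** On [[t, t']] the difference [cumul f u - cumul f t] is the integral from [t] to [u], which is
    continuous in [u]. *)
Lemma cumul_IVT t t' x : t <= t' -> cumul f t <= x <= cumul f t' ->
  exists2 u, t <= u <= t' & cumul f u = x.
Proof.
move=> tt' /andP[tx xt'].
pose F u := parameterized_integral mu t u f.
have FE u : t <= u -> F u = cumul f u - cumul f t.
  move=> tu; rewrite /F /parameterized_integral /Rintegral.
  by rewrite -integral_itv_obnd_cbnd ?cumulB//; exact: nni_measurable_EFin.
have cF : {within `[t, t'], continuous F}.
  apply: parameterized_integral_continuous => //.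
  by apply: nni_integrable; exact: measurable_itv.
have [|u] := @IVT _ F t t' (x - cumul f t) tt' cF.
  have Ft'_ge0 : 0 <= cumul f t' - cumul f t by rewrite subr_ge0 cumul_le.
  by rewrite !FE// subrr min_l// max_r//; apply/andP; split; lra.
rewrite in_itv/= => /andP[tu ut']; rewrite FE// => /(congr1 (fun y => y + cumul f t)).
by rewrite !subrK => ux; exists u => //; rewrite tu.
Qed.

Lemma cumul_eq0 t : (forall u, u <= t -> f u = 0) -> cumul f t = 0.
Proof.
move=> ft; apply: EFin_inj; rewrite -cumulE integral0_eq// => u /=.
by rewrite in_itv/= => /ft ->.
Qed.

Lemma cumul_const t t' : t <= t' -> (forall u, t < u <= t' -> f u = 0) ->
  cumul f t' = cumul f t.
Proof.
move=> tt' f_eq0; apply/eqP; rewrite -subr_eq0; apply/eqP/EFin_inj.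
rewrite -cumulB// integral0_eq// => u /=.
by rewrite in_itv/= => /f_eq0 ->.
Qed.

End OneFunction.

Lemma cumul_ler f g t t' : nn_integrable f -> nn_integrable g -> t <= t' ->
  (forall u, t < u <= t' -> f u <= g u) ->
  cumul f t' - cumul f t <= cumul g t' - cumul g t.
Proof.
move=> nf ng tt' fg; rewrite -lee_fin -!cumulB//; apply: ge0_le_integral.
- exact: measurable_itv.
- by move=> x _; rewrite lee_fin (nni_ge0 nf).
- exact: nni_measurable_EFin.
- exact: nni_measurable_EFin.
- by move=> x; rewrite /= in_itv/= => xt; rewrite lee_fin fg.
Qed.

Lemma cumul_mono f g t : nn_integrable f -> nn_integrable g ->
  (forall u, u <= t -> f u <= g u) -> cumul f t <= cumul g t.
Proof.
move=> nf ng fg; rewrite -lee_fin -!cumulE//; apply: ge0_le_integral.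
- exact: measurable_itv.
- by move=> x _; rewrite lee_fin (nni_ge0 nf).
- exact: nni_measurable_EFin.
- exact: nni_measurable_EFin.
- by move=> x; rewrite /= in_itv/= => xt; rewrite lee_fin fg.
Qed.

Lemma nn_integrable_sum (I : Type) (r : seq I) (p : pred I) (F : I -> R -> R) :
  (forall i, nn_integrable (F i)) ->
  nn_integrable (fun t => \sum_(i <- r | p i) F i t).
Proof.
move=> nF; split.
- under eq_fun do rewrite big_mkcond.
  apply: measurable_sum => i; case: (p i); last exact: measurable_cst.
  exact: nni_measurable.
- by move=> t; apply: sumr_ge0 => i _; exact: nni_ge0.
- under eq_integral do rewrite -sumEFin big_mkcond.
  rewrite ge0_integral_sum//; last 2 first.
  + move=> i; case: (p i); last exact: measurable_cst.
    exact: nni_measurable_EFin.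
  + by move=> i x _; case: (p i); rewrite // lee_fin (nni_ge0 (nF i)).
  apply: lte_sum_pinfty => i _; case: (p i); first exact: nni_fin.
  by rewrite integral0.
Qed.

Lemma cumul_sum (I : Type) (r : seq I) (p : pred I) (F : I -> R -> R) t :
  (forall i, nn_integrable (F i)) ->
  cumul (fun t => \sum_(i <- r | p i) F i t) t = \sum_(i <- r | p i) cumul (F i) t.
Proof.
move=> nF; apply: EFin_inj; rewrite -cumulE; last exact: nn_integrable_sum.
rewrite -sumEFin; under eq_integral do rewrite -sumEFin big_mkcond.
rewrite ge0_integral_sum//; last 2 first.
- move=> i; case: (p i); last exact: measurable_cst.
  exact: nni_measurable_EFin.
- by move=> i x _; case: (p i); rewrite // lee_fin (nni_ge0 (nF i)).
rewrite [RHS]big_mkcond; apply: eq_bigr => i _.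
by case: (p i); [exact: cumulE | exact: integral0].
Qed.

Lemma nn_integrableZ (c : R) f : 0 <= c -> nn_integrable f ->
  nn_integrable (fun t => c * f t).
Proof.
move=> c0 nf; split.
- by apply: measurable_funM; [exact: measurable_cst | exact: nni_measurable].
- by move=> t; rewrite mulr_ge0 ?(nni_ge0 nf).
- under eq_integral do rewrite EFinM.
  rewrite ge0_integralZl_EFin//.
  + have := nni_fin nf; have : (0 <= \int[mu]_t (f t)%:E)%E.
      by apply: integral_ge0 => x _; rewrite lee_fin (nni_ge0 nf).
    by case: (\int[mu]_t _)%E => //= r _ _; rewrite -EFinM ltry.
  + by move=> x _; rewrite lee_fin (nni_ge0 nf).
  + exact: nni_measurable_EFin.
Qed.

Lemma cumulZ (c : R) f t : 0 <= c -> nn_integrable f ->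
  cumul (fun t => c * f t) t = c * cumul f t.
Proof.
move=> c0 nf; apply: EFin_inj; rewrite -cumulE; last exact: nn_integrableZ.
under eq_integral do rewrite EFinM.
rewrite ge0_integralZl_EFin//; first by rewrite cumulE.
- by move=> x _; rewrite lee_fin (nni_ge0 nf).
- exact: nni_measurable_EFin.
Qed.

Lemma nn_integrableD f g : nn_integrable f -> nn_integrable g ->
  nn_integrable (fun t => f t + g t).
Proof.
move=> nf ng; have := @nn_integrable_sum bool [:: true; false] xpredT
  (fun b => if b then f else g) (fun b => _).
under eq_fun do rewrite !big_cons big_nil addr0.
by apply; case.
Qed.

Lemma cumulD f g t : nn_integrable f -> nn_integrable g ->
  cumul (fun t => f t + g t) t = cumul f t + cumul g t.
Proof.
move=> nf ng; have := @cumul_sum bool [:: true; false] xpredT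
  (fun b => if b then f else g) t (fun b => _).
under eq_fun do rewrite !big_cons big_nil addr0.
by rewrite !big_cons big_nil addr0; apply; case.
Qed.

End Cumulative.

(** * Feasible schedules *)

Section FeasibleSchedule.
Context {R : realType} {K n : nat} {a : 'I_n -> R} {r : schedule R K n}.
Hypothesis fr : feasible a r.
Local Notation mu := (@lebesgue_measure R).
Implicit Types (k i : 'I_K) (j : 'I_n) (t u : R).

Local Notation w k j := (cumul (r k j)).

Lemma rate_integrable k j : nn_integrable (r k j).
Proof.
have mr := fs_measurable fr k j; have r0 := fs_ge0 fr k j.
split=> //; apply: (@le_lt_trans _ _ 1%:E); last exact: ltry.
by apply: ge0_integral_le_upto => // t; exact: (fs_work_le1 fr).
Qed.

Lemma workE k j t : work r k j t = (w k j t)%:E.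
Proof. by rewrite /work cumulE//; exact: rate_integrable. Qed.

Lemma work_le1 k j t : w k j t <= 1.
Proof. by rewrite -lee_fin -workE; exact: (fs_work_le1 fr). Qed.

Lemma work_ge0 k j t : 0 <= w k j t.
Proof. exact/cumul_ge0/rate_integrable. Qed.

Lemma completed_beforeE m k j t : m = k.+1 ->
  completed_before r m j t = (1 <= w k j t).
Proof.
move=> ->; apply/forallP/idP => [/(_ k)|wk i]; first by rewrite eqxx workE lee_fin.
by apply/implyP => /eqP[/ord_inj->]; rewrite workE lee_fin.
Qed.

Lemma completed_beforeS k j t : completed_before r k.+1 j t = (1 <= w k j t).
Proof. exact: completed_beforeE. Qed.

Lemma completed_before0 j t : completed_before r 0 j t.
Proof. by apply/forallP => i; rewrite eqn0Ngt. Qed.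

Lemma completed_before_le m j t t' : t <= t' ->
  completed_before r m j t -> completed_before r m j t'.
Proof.
move=> tt' /forallP h; apply/forallP => i; apply/implyP => im.
move: (h i); rewrite im !workE !lee_fin/= => /le_trans; apply.
exact/cumul_le/tt'/rate_integrable.
Qed.

(** Positive work requires a positive rate at some earlier time; the job was available then, and
    availability persists. *)
Lemma work_gt0_available k j t : 0 < w k j t -> available a r k j t.
Proof.
move=> w0; have [u [ut /(fs_available fr)/andP[au cu]]] : exists u, u <= t /\ 0 < r k j u.
  apply/not_existsP => h; move: w0; rewrite cumul_eq0 ?ltxx//; first exact: rate_integrable.
  move=> u ut; apply/eqP; rewrite eq_le (fs_ge0 fr) andbT leNgt; apply/negP => ru.
  exact: (h u).
by rewrite /available (le_trans au ut)/=; apply: completed_before_le cu.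
Qed.

Lemma work_arrived k j t : 0 < w k j t -> a j <= t.
Proof. by move=> /work_gt0_available/andP[]. Qed.

(** Descend one server at a time: a server that has worked on a job received it completed from its
    predecessor. *)
Lemma work_prev k i j t : (i <= k)%N -> 1 <= w k j t -> 1 <= w i j t.
Proof.
move=> ik; have [m] := ubnP (k - i)%N; elim: m k ik => // m IH k ik km wk.
move: ik; rewrite leq_eqVlt => /predU1P[/ord_inj->//|ik].
have k1K : (k.-1 < K)%N by rewrite (leq_ltn_trans (leq_pred k)).
have kE : k = (Ordinal k1K).+1 :> nat by rewrite /= prednK ?(leq_ltn_trans _ ik).
apply: (IH (Ordinal k1K)) => /=; [lia|lia|].
have /andP[_] := work_gt0_available (lt_le_trans ltr01 wk).
by rewrite (completed_beforeE _ _ kE).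
Qed.

Lemma completed_all k j t : completed_before r K j t -> 1 <= w k j t.
Proof.
have K_gt0 := leq_ltn_trans (leq0n k) (ltn_ord k).
have K1K : (K.-1 < K)%N by rewrite ltn_predL.
rewrite (@completed_beforeE K (Ordinal K1K)) ?prednK//.
by apply: work_prev; rewrite /= -ltnS prednK.
Qed.

Lemma speed_integrable k : nn_integrable (speed r k).
Proof. by apply: nn_integrable_sum => j; exact: rate_integrable. Qed.

Lemma speed_ge0 k t : 0 <= speed r k t.
Proof. exact: (nni_ge0 (speed_integrable k)). Qed.

Lemma cumul_speed k t : cumul (speed r k) t = \sum_(j < n) w k j t.
Proof. by apply: cumul_sum => j; exact: rate_integrable. Qed.

Lemma cumul_speed_le k t : cumul (speed r k) t <= n%:R.
Proof.
rewrite cumul_speed; apply: (@le_trans _ _ (\sum_(j < n) 1)).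
  by apply: ler_sum => j _; exact: work_le1.
by rewrite sumr_const card_ord.
Qed.

(** Supplies the time with zero work from which the intermediate value arguments start. *)
Lemma before_arrivals t : exists2 t0, t0 <= t & forall k j, w k j t0 = 0.
Proof.
(* Subtracting 1 puts this time strictly before every arrival. *)
exists (Num.min t (\big[Num.min/t]_j a j - 1)); first by rewrite ge_min lexx.
move=> k j; apply/eqP; rewrite eq_le work_ge0 andbT leNgt; apply/negP.
move=> /work_arrived; apply/negP; rewrite -ltNge gt_min; apply/orP; right.
have : \big[Num.min/t]_j a j <= a j by exact: bigmin_le_cond.
lra.
Qed.

Lemma work_IVT k j t x : 0 <= x <= w k j t -> exists2 u, u <= t & w k j u = x.
Proof.
have [t0 t0t w0] := before_arrivals t.
move=> x_itv; have [|u /andP[_ ut] wu] := cumul_IVT (rate_integrable k j) t0t (x := x).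
  by rewrite w0.
by exists u.
Qed.

Lemma speed_IVT k t x : 0 <= x <= cumul (speed r k) t ->
  exists2 u, u <= t & cumul (speed r k) u = x.
Proof.
have [t0 t0t w0] := before_arrivals t.
move=> x_itv; have [|u /andP[_ ut] wu] := cumul_IVT (speed_integrable k) t0t (x := x).
  by rewrite [X in X <= _](_ : _ = 0)// cumul_speed big1.
by exists u.
Qed.

Lemma njobsE t : (njobs a r t)%:R =
  \sum_(j < n) ((a j <= t) && ~~ completed_before r K j t)%:R :> R.
Proof.
rewrite /njobs cardsE -sum1_card natr_sum big_mkcond; apply: eq_bigr => j _.
by rewrite unfold_in; case: (_ && _).
Qed.

Lemma queueE k t : (queue a r k t)%:R = \sum_(j < n) (outstanding a r k j t)%:R :> R.
Proof.
rewrite /queue cardsE -sum1_card natr_sum big_mkcond; apply: eq_bigr => j _.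
by rewrite unfold_in /outstanding; case: (_ && _).
Qed.

Lemma measurable_arrived j : measurable_fun setT (fun t => (a j <= t)%R%:R : R).
Proof.
apply: nondecreasing_measurable => // s t st. Show. 
by case: (boolP (a j <= s)) => [/le_trans/(_ st)->|_]; rewrite ?ler0n.
Qed.

Lemma measurable_completed m j :
  measurable_fun setT (fun t => (completed_before r m j t)%:R : R).
Proof.
apply: nondecreasing_measurable => // s t st. Show. 
by case: (boolP (completed_before r m j s)) => [/(completed_before_le st)->|_]; rewrite ?ler0n.
Qed.

Lemma measurable_njobs : measurable_fun setT (fun t => (njobs a r t)%:R : R).
Proof.
under eq_fun do rewrite njobsE.
apply: measurable_sum => j.
under eq_fun do rewrite -mulnb natrM.
apply: measurable_funM; first exact: measurable_arrived.
rewrite (_ : (fun x => _) = (fun t => 1 - (completed_before r K j t)%:R)).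
  by apply: measurable_funB; [exact: measurable_cst|exact: measurable_completed].
by apply/funext => t; case: (completed_before _ _ _ _); rewrite ?subrr ?subr0.
Qed.

Lemma outstandingE k j t : outstanding a r k j t =
  (a j <= t) && (completed_before r k j t) && ~~ completed_before r k.+1 j t.
Proof. by rewrite /outstanding completed_beforeS workE lte_fin ltNge. Qed.

Lemma measurable_queue k : measurable_fun setT (fun t => (queue a r k t)%:R : R).
Proof.
under eq_fun do rewrite queueE.
apply: measurable_sum => j.
under eq_fun do rewrite outstandingE -!mulnb !natrM.
apply: measurable_funM.
  by apply: measurable_funM; [exact: measurable_arrived|exact: measurable_completed].
rewrite (_ : (fun x => _) = (fun t => 1 - (completed_before r k.+1 j t)%:R)).
  by apply: measurable_funB; [exact: measurable_cst|exact: measurable_completed].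
by apply/funext => t; case: (completed_before _ _ _ _); rewrite ?subrr ?subr0.
Qed.

End FeasibleSchedule.

(** * A lower bound on the cost of every schedule *)

Section LowerBound.
Context {R : realType} {K n : nat} {P Pinv : R -> R} {a : 'I_n -> R} {r : schedule R K n}.
Hypotheses (pf : power_function P Pinv) (fr : feasible a r).
Local Notation mu := (@lebesgue_measure R).
Implicit Types (k i : 'I_K) (j : 'I_n) (t u : R).
Local Notation w k j := (cumul (r k j)).

Definition cost_rate (t : R) : R :=
  (njobs a r t)%:R + \sum_(k < K) P (speed r k t).

Lemma measurable_power_speed k : measurable_fun setT (fun t => P (speed r k t)).
Proof.
(* [P] is monotone only on nonnegative arguments; clipping the argument at 0 gives a function that
   is monotone, hence measurable, on the whole line. *)
rewrite (_ : (fun t => _) = (fun x => P (Num.max 0 x)) \o speed r k); last first.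
  by apply/funext => t /=; rewrite max_r// (speed_ge0 fr).
apply: measurableT_comp; last by apply: nni_measurable; exact: (speed_integrable fr).
apply: nondecreasing_measurable => // s t st.
by apply: (power_le pf); rewrite ?ge_max !le_max lexx ?st ?orbT.
Qed.

Lemma power_speed_ge0 k t : 0 <= P (speed r k t).
Proof. by rewrite (pf_ge0 pf)// (speed_ge0 fr). Qed.

Lemma measurable_cost_rate : measurable_fun setT cost_rate.
Proof.
apply: measurable_funD; first exact: (measurable_njobs fr).
by apply: measurable_sum => k; exact: measurable_power_speed.
Qed.

Lemma cost_rate_ge0 t : 0 <= cost_rate t.
Proof. by rewrite addr_ge0// sumr_ge0// => k _; exact: power_speed_ge0. Qed.

Lemma costE : cost P a r = (\int[mu]_t (cost_rate t)%:E)%E.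
Proof.
under eq_integral do rewrite /cost_rate EFinD.
rewrite ge0_integralD//.
- by apply/measurable_EFinP; exact: (measurable_njobs fr).
- by move=> t _; rewrite lee_fin sumr_ge0// => k _; exact: power_speed_ge0.
- apply/measurable_EFinP; apply: measurable_sum => k.
  exact: measurable_power_speed.
Qed.

(* [r k j] may be positive on a null set of times after server [k] has completed
   job [j]; such times are excluded. *)
Let busy k j t := (0 < r k j t) && (w k j t < 1).

Let busy_prev k i j t : (i < k)%N -> busy k j t -> 1 <= w i j t.
Proof.
move=> ik /andP[rk _]; have /andP[_] := fs_available fr rk.
have k1K : (k.-1 < K)%N by rewrite (leq_ltn_trans (leq_pred k)).
rewrite (@completed_beforeE _ _ _ _ _ fr k (Ordinal k1K)) /= ?prednK ?(leq_ltn_trans _ ik)//.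
by apply: (work_prev fr) => /=; lia.
Qed.

(** A job is busy at no more than one server: being served at a later one means being completed at
    all earlier ones. A busy job is still in the system. *)
Let busy_njobs t : \sum_(k < K) \sum_(j < n) (busy k j t)%:R <= (njobs a r t)%:R :> R.
Proof.
rewrite exchange_big/= njobsE; apply: ler_sum => j _.
have [/existsP[k bk]|/existsPn nb] := boolP [exists k, busy k j t]; last first.
  by rewrite big1// => k _; rewrite (negbTE (nb k)).
rewrite (bigD1 k)//= big1 ?addr0; last first.
  move=> i ik; apply/eqP; rewrite pnatr_eq0 eqb0; apply/negP => bi.
  have [||ki] := ltngtP i k; last by rewrite (ord_inj ki) eqxx in ik.
    by move=> /busy_prev/(_ bk); case/andP: bi => _; rewrite ltNge => /negP.
  by move=> /busy_prev/(_ bi); case/andP: bk => _; rewrite ltNge => /negP.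
move: (bk) => /andP[rk wk].
have /andP[-> _] := fs_available fr rk.
rewrite bk/=; case: (boolP (completed_before r K j t)) => // /(completed_all fr k).
by rewrite leNgt wk.
Qed.

(** * Charging each unit of useful work by the tangent at [s] *)

Section Tangent.
Variable s : R.
Hypotheses (s_gt0 : 0 < s) (sP : 1 + P s = s * derive1 P s).

(** The rate cut off once the job is completed, so that a positive useful rate implies [busy]. *)
Let useful k j t := r k j t * (w k j t < 1)%R%:R.

Let useful_ge0 k j t : 0 <= useful k j t.
Proof. by rewrite mulr_ge0// (fs_ge0 fr). Qed.

Let measurable_useful k j : measurable_fun setT (useful k j).
Proof.
apply: measurable_funM; first exact: (fs_measurable fr).
rewrite (_ : (fun t => _) = (fun t => 1 - (completed_before r k.+1 j t)%:R)).
  apply: measurable_funB; first exact: measurable_cst.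
  exact: (measurable_completed fr).
apply/funext => t; rewrite (completed_beforeS fr) ltNge.
by case: (1 <= _); rewrite ?subrr ?subr0.
Qed.

Let useful_cost_rate t :
  \sum_(k < K) \sum_(j < n) derive1 P s * useful k j t <= cost_rate t.
Proof.
have dP := derive_power_gt0 pf s_gt0.
rewrite /cost_rate; apply: le_trans (lerD (busy_njobs t) (lexx _)).
rewrite -big_split/=; apply: ler_sum => k _; rewrite -mulr_sumr.
have P0 := power_speed_ge0 k t.
have [/existsP[j bj]|/existsPn nb] := boolP [exists j, busy k j t]; last first.
  rewrite !big1 ?mulr0 ?add0r// => j _; first by rewrite (negbTE (nb j)).
  move: (nb j); rewrite /busy /useful negb_and -leNgt => /orP[r0|/negbTE->].
    by rewrite (le_anti (_ : r k j t <= 0 <= r k j t)) ?mul0r// r0 (fs_ge0 fr).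
  by rewrite mulr0.
have b1 : 1 <= \sum_(j < n) (busy k j t)%:R :> R.
  by rewrite (bigD1 j)//= bj lerDl sumr_ge0.
have us : \sum_(j < n) useful k j t <= speed r k t.
  apply: ler_sum => i _; rewrite /useful ler_piMr ?(fs_ge0 fr)// lern1.
  by case: (_ < _).
have := power_tangent pf s_gt0 (speed_ge0 fr k t).
have : derive1 P s * \sum_(j < n) useful k j t <= derive1 P s * speed r k t.
  by rewrite ler_pM2l.
move: sP; lra.
Qed.

(** Such a job stays in the system from [a j] on and contributes at least 1 to the cost rate
    forever. *)
Let cost_pinfty k j : (forall t, w k j t < 1) -> cost P a r = +oo%E.
Proof.
move=> wk; apply/eqP; rewrite -leye_eq costE.
have -> : (+oo = \int[mu]_(t in [set` `[a j, +oo[]) (1 : \bar R))%E.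
  rewrite integral_cst// mul1e; apply/esym.
  by have := @lebesgue_measure_itv R `[a j, +oo[; rewrite /= ltry; exact.
apply: (@le_trans _ _ (\int[mu]_(t in [set` `[a j, +oo[]) (cost_rate t)%:E)%E).
  apply: ge0_le_integral => //.
  - by apply/measurable_EFinP; apply: measurable_funTS; exact: measurable_cost_rate.
  - move=> t; rewrite /= in_itv/= andbT => ajt; rewrite lee_fin /cost_rate.
    rewrite -[leLHS]addr0; apply: lerD; last by rewrite sumr_ge0// => i _; exact: power_speed_ge0.
    rewrite njobsE (bigD1 j)//= ajt/=.
    have -> : ~~ completed_before r K j t.
      by apply/negP => /(completed_all fr k); rewrite leNgt wk.
    by rewrite lerDl sumr_ge0.
apply: ge0_subset_integral => //.
- by apply/measurable_EFinP; exact: measurable_cost_rate.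
- by move=> t _; rewrite lee_fin cost_rate_ge0.
Qed.

(** For each [c < 1], the work equals [c] at some time [u], and up to [u] the useful rate is the
    full rate. Letting [c] approach 1 gives the bound. *)
Let useful_ge1 k j t : 1 <= w k j t -> (1 <= \int[mu]_u (useful k j u)%:E)%E.
Proof.
move=> wt.
have nr := rate_integrable fr k j.
have key c : 0 <= c -> c < 1 -> (c%:E <= \int[mu]_u (useful k j u)%:E)%E.
  move=> c0 c1; have [|u _ wu] := @work_IVT _ _ _ _ _ fr k j t c.
    by rewrite c0 (le_trans (ltW c1)).
  rewrite -wu -cumulE//.
  have -> : (\int[mu]_(v in [set` `]-oo, u]]) (r k j v)%:E =
      \int[mu]_(v in [set` `]-oo, u]]) (useful k j v)%:E)%E.
    apply: eq_integral => v; rewrite inE/= in_itv/= => vu; rewrite /useful.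
    by rewrite (le_lt_trans (cumul_le nr vu)) ?wu// mulr1.
  apply: ge0_subset_integral => //.
  - by apply/measurable_EFinP; exact: measurable_useful.
  - by move=> v _; rewrite lee_fin.
have := key 0 (lexx _) ltr01.
case: (integral _ _ _) key => [x key|_ _|//]; last by rewrite leey.
rewrite !lee_fin => x0; rewrite leNgt; apply/negP => x1.
by have := key ((x + 1) / 2); rewrite lee_fin; lra.
Qed.

(* The tangent at [s] gives [derive1 P s * x <= 1 + P x], and the jobs in service
   at the busy servers are distinct, so that they pay for the summands 1. *)
Lemma cost_lower_bound : ((n%:R * K%:R * derive1 P s)%:E <= cost P a r)%E.
Proof.
have dP := ltW (derive_power_gt0 pf s_gt0).
have [[k [j wkj]]|h] := pselect (exists k j, forall t, w k j t < 1).
  by rewrite (cost_pinfty wkj) leey.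
apply: (@le_trans _ _ (\int[mu]_t (\sum_(k < K) \sum_(j < n) (derive1 P s * useful k j t)%:E))%E).
  rewrite ge0_integral_sum//; last 2 first.
  - move=> k; apply: emeasurable_sum => j; apply/measurable_EFinP.
    by apply: measurable_funM; [exact: measurable_cst|exact: measurable_useful].
  - by move=> k t _; apply: sume_ge0 => j _; rewrite lee_fin mulr_ge0.
  have -> : n%:R * K%:R * derive1 P s = \sum_(k < K) \sum_(j < n) derive1 P s.
    rewrite -mulr_natl sumr_const card_ord sumr_const card_ord; ring.
  rewrite -sumEFin; apply: lee_sum => k _.
  rewrite ge0_integral_sum//; last 2 first.
  - move=> j; apply/measurable_EFinP.
    by apply: measurable_funM; [exact: measurable_cst|exact: measurable_useful].
  - by move=> j t _; rewrite lee_fin mulr_ge0.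
  rewrite -sumEFin; apply: lee_sum => j _.
  under eq_integral do rewrite EFinM.
  rewrite ge0_integralZl_EFin//; last 2 first.
  - by move=> t _; rewrite lee_fin.
  - by apply/measurable_EFinP; exact: measurable_useful.
  rewrite -[leLHS]mule1 lee_wpmul2l ?lee_fin//.
  have [t wt] : exists t, 1 <= w k j t.
    apply: contra_notP h => /forallNP h; exists k, j => t.
    by rewrite ltNge; apply/negP; exact: h.
  exact: useful_ge1 wt.
rewrite costE; apply: ge0_le_integral => //.
- by move=> t _; do 2 (apply: sume_ge0 => ? _); rewrite lee_fin mulr_ge0.
- apply: emeasurable_sum => k; apply: emeasurable_sum => j; apply/measurable_EFinP.
  by apply: measurable_funM; [exact: measurable_cst|exact: measurable_useful].
- by apply/measurable_EFinP; exact: measurable_cost_rate.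
- move=> t _; under eq_bigr do rewrite sumEFin.
  by rewrite sumEFin lee_fin; exact: useful_cost_rate.
Qed.

End Tangent.
End LowerBound.

(** * The online algorithm *)

Section Online.
Context {R : realType} {K n : nat} {P Pinv : R -> R} {a : 'I_n -> R} {r : schedule R K n}.
Hypotheses (pf : power_function P Pinv) (K_gt0 : (0 < K)%N) (onl : online a Pinv r).
Let fr := on_feasible onl.
Implicit Types (k i : 'I_K) (j : 'I_n) (t u : R).
Local Notation w k j := (cumul (r k j)).
Local Notation S k := (cumul (speed r k)).
Local Notation k0 := (Ordinal K_gt0).

(** Two partially processed jobs would both be served at the full speed of the server by
    nonpreemption, which forces that speed to be 0, although one of the jobs still progresses. *)
Lemma partial_unique k j j' t : 0 < w k j t < 1 -> 0 < w k j' t < 1 -> j = j'.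
Proof.
move=> wj wj'; apply: contrapT => jj'.
(* Let [j] be the job that reaches half of its present work first. From [u'] to [t] both jobs are
   strictly between 0 and 1, yet [j'] must gain its second half. *)
wlog [u [u' [uu' u't wu wu']]] : j j' wj wj' jj' / exists u u',
    [/\ u <= u', u' <= t, w k j u = w k j t / 2 & w k j' u' = w k j' t / 2].
  move=> wlg.
  have half j1 : 0 < w k j1 t < 1 -> exists2 u, u <= t & w k j1 u = w k j1 t / 2.
    by move=> wj1; apply: (work_IVT fr); lra.
  have [u ut wu] := half j wj; have [u' ut' wu'] := half j' wj'.
  have [uu'|/ltW uu'] := leP u u'; first by apply: (wlg j j') => //; exists u, u'.
  by apply: (wlg j' j) => //; [exact/nesym|exists u', u].
suff : w k j' t = w k j' u' by rewrite wu'; lra.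
have nr j1 := rate_integrable fr k j1.
apply: (cumul_const (nr j')) => // v /andP[u'v vt].
have pj : r k j v = speed r k v.
  have := cumul_le (nr j) (le_trans uu' (ltW u'v)); have := cumul_le (nr j) vt.
  by move=> ? ?; apply: (on_nonpreemptive onl); rewrite (workE fr) lte_fin; lra.
have pj' : r k j' v = speed r k v.
  have := cumul_le (nr j') (ltW u'v); have := cumul_le (nr j') vt.
  by move=> ? ?; apply: (on_nonpreemptive onl); rewrite (workE fr) lte_fin; lra.
have : r k j v + r k j' v <= speed r k v.
  rewrite /speed (bigD1 j)//= (bigD1 j')//=; last by apply/eqP/nesym.
  by rewrite addrA lerDl sumr_ge0// => j1 _; exact: (fs_ge0 fr).
have := fs_ge0 fr k j' v; lra.
Qed.

Definition completions k t : nat := \sum_(j < n) (1 <= w k j t)%R.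

Lemma completions_le k t : (completions k t)%:R <= S k t.
Proof.
rewrite (cumul_speed fr) /completions natr_sum; apply: ler_sum => j _.
by case: (boolP (1 <= _)) => // _; exact: (work_ge0 fr).
Qed.

(** Work beyond the completed jobs comes from the at most one partially processed job, and is less
    than 1. *)
Lemma completions_gt k t : S k t < (completions k t)%:R + 1.
Proof.
rewrite (cumul_speed fr) /completions natr_sum -ltrBlDl -sumrB.
have done j : 1 <= w k j t -> w k j t - 1 = 0.
  by have := work_le1 fr k j t; lra.
have [/existsP[j pj]|/existsPn np] := boolP [exists j, 0 < w k j t < 1].
  rewrite (bigD1 j)//= big1 ?addr0 => [|j' j'j].
    by case/andP: pj => _ pj; rewrite leNgt pj /=; lra.
  have [/done//|w1] := leP 1 (w k j' t); rewrite subr0.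
  apply/eqP; rewrite eq_le (work_ge0 fr) andbT leNgt; apply/negP => w0.
  by move/eqP: j'j; apply; apply: (partial_unique (t := t) (k := k)) => //; rewrite w0.
rewrite big1 ?ltr01// => j _.
have [/done//|w1] := leP 1 (w k j t); rewrite subr0.
apply/eqP; rewrite eq_le (work_ge0 fr) andbT leNgt; apply/negP => w0.
by have := np j; rewrite w0 w1.
Qed.

Lemma queue1E t : queue1 a r t = queue a r k0 t.
Proof. by rewrite /queue1 (big_pred1 k0) => // k; rewrite -val_eqE. Qed.

Definition common_power t : R :=
  if (0 < queue a r k0 t)%N
  then (queue a r k0 t + nactive a r t + 1)%:R / (nactive a r t + 1)%:R else 2.

Lemma common_power_ge1 t : 1 <= common_power t.
Proof.
rewrite /common_power; case: ifP => _; last by rewrite ler1n.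
by rewrite !addn1 ler_pdivlMr ?ltr0n// mul1r ler_nat ltnS leq_addl.
Qed.

Lemma online_speedE k t :
  speed r k t = if (0 < queue a r k t)%N then Pinv (common_power t) else 0.
Proof.
rewrite (on_speed onl) /online_speed queue1E /common_power.
case: eqVneq => [k_eq0|_]; last first.
  by case: (0 < queue a r k t)%N; case: (0 < queue a r k0 t)%N.
by have -> : k = k0; [exact/ord_inj | case: (0 < queue a r k0 t)%N].
Qed.

(** * Equal speeds keep the downstream queues short *)

Lemma lockstep i k t : (0 < queue a r k t)%N -> speed r i t <= speed r k t.
Proof.
move=> qk; rewrite !online_speedE qk; case: ifP => // _.
by rewrite (pf_inv_ge0 pf)// (le_trans ler01)// common_power_ge1.
Qed.

(** Some job is completed at [i] but not at [k], and it is outstanding at [k]. *)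
Lemma lagging_queue i k t : k = i.+1 :> nat ->
  (completions k t < completions i t)%N -> (0 < queue a r k t)%N.
Proof.
move=> ki lt_c; rewrite card_gt0; apply/set0Pn.
have [/existsP[j /andP[wi wk]]|/existsPn nj] :=
    boolP [exists j, (1 <= w i j t) && ~~ (1 <= w k j t)].
  exists j; rewrite inE (outstandingE fr) (completed_beforeS fr) wk andbT.
  rewrite (completed_beforeE fr _ _ ki) wi andbT.
  by apply: (work_arrived fr (k := i)); exact: lt_le_trans wi.
move: lt_c; rewrite ltnNge; case/negP.
apply: leq_sum => j _; have := nj j.
by case: (1 <= w i j t) => //=; rewrite negbK => ->.
Qed.

(* From the time [u] when server [i] has done work [m.+1], server [k] is active
   until it has done work [m.+1], hence at least as fast as server [i]. *)
Lemma lag_le1 i k t m : k = i.+1 :> nat -> m.+1%:R <= S i t -> m%:R <= S k t.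
Proof.
move=> ki; elim: m t => [|m IH] t Si; first exact/cumul_ge0/(speed_integrable fr).
rewrite leNgt; apply/negP => Sk.
have ni := speed_integrable fr i; have nk := speed_integrable fr k.
have [|u ut Su] := @speed_IVT _ _ _ _ _ fr i t m.+1%:R.
  by rewrite ler0n (le_trans _ Si)// ler_nat.
have := IH u; rewrite Su => /(_ (lexx _)) Sku.
have : S i t - S i u <= S k t - S k u.
  apply: cumul_ler => // v /andP[uv vt]; apply: lockstep.
  apply: (@lagging_queue i) => //.
  have ci := completions_gt i v; have ck := completions_le k v.
  have Siv := cumul_le ni (ltW uv); have Skv := cumul_le nk vt.
  rewrite Su in Siv.
  have cim : (m < completions i v)%N.
    by rewrite -ltnS -(ltr_nat R); apply: le_lt_trans Siv _; rewrite -natr1.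
  have ckm : (completions k v < m.+1)%N.
    by rewrite -(ltr_nat R) (le_lt_trans ck)// (le_lt_trans Skv).
  lia.
rewrite Su; move: Si Sk; rewrite -!natr1; lra.
Qed.

(** With two outstanding jobs at [k], its predecessor has completed at least two more jobs than [k].
    By [lag_le1], server [k] has then done one unit more than its completions, against
    [completions_gt]. *)
Lemma queue_le1 k t : (0 < k)%N -> (queue a r k t <= 1)%N.
Proof.
move=> k_gt0.
have k1K : (k.-1 < K)%N by rewrite (leq_ltn_trans (leq_pred k)).
pose i := Ordinal k1K.
have ki : k = i.+1 :> nat by rewrite /= prednK.
have qc : (queue a r k t + completions k t <= completions i t)%N.
  rewrite -(ler_nat R) natrD queueE /completions !natr_sum -big_split/=.
  apply: ler_sum => j _; rewrite (outstandingE fr) (completed_beforeE fr _ _ ki).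
  rewrite (completed_beforeS fr).
  have := @work_prev _ _ _ _ _ fr k i j t; rewrite leq_pred => /(_ isT).
  case: (1 <= w k j t) => [->//|_]; first by rewrite !andbF add0r.
  by case: (a j <= t); case: (1 <= w i j t); rewrite /= ?addr0.
rewrite leqNgt; apply/negP => q2.
have : (completions k t).+1%:R <= S k t.
  apply: (@lag_le1 i) => //; apply: le_trans (completions_le i t).
  by rewrite ler_nat; lia.
by have := completions_gt k t; rewrite -natr1; lra.
Qed.

Lemma nactiveE t : (nactive a r t)%:R =
  \sum_(k < K | (0 < k)%N) (0 < queue a r k t)%N%:R :> R.
Proof.
rewrite /nactive cardsE -sum1_card natr_sum big_mkcond [RHS]big_mkcond.
by apply: eq_bigr => k _; rewrite unfold_in; case: (0 < k)%N; case: (0 < queue _ _ _ _)%N.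
Qed.

Lemma sum_active t : \sum_(k < K) (0 < queue a r k t)%N%:R =
  (0 < queue a r k0 t)%N%:R + (nactive a r t)%:R :> R.
Proof.
rewrite (bigD1 k0)//= nactiveE; congr (_ + _); apply: eq_bigl => k.
by rewrite -val_eqE/= lt0n.
Qed.

(** Each job in the system is outstanding at the first server that has not completed it, and every
    queue but the first has length at most 1. *)
Lemma njobs_le t : (njobs a r t)%:R <= (queue a r k0 t)%:R + (nactive a r t)%:R :> R.
Proof.
apply: (@le_trans _ _ (\sum_(k < K) (queue a r k t)%:R)); last first.
  rewrite (bigD1 k0)//= lerD2l nactiveE.
  rewrite (eq_bigl (fun k : 'I_K => (0 < k)%N)); last by move=> k; rewrite -val_eqE/= lt0n.
  apply: ler_sum => k k_gt0; have := queue_le1 t k_gt0.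
  by case: (queue a r k t) => [|[]].
under eq_bigr do rewrite queueE.
rewrite njobsE exchange_big/=; apply: ler_sum => j _.
have [|] := boolP ((a j <= t) && _); last by rewrite sumr_ge0.
move=> /andP[ajt ncK].
have K1K : (K.-1 < K)%N by rewrite ltn_predL.
have ncl : ~~ (1 <= w (Ordinal K1K) j t).
  by rewrite -(@completed_beforeE _ _ _ _ _ fr K)//= prednK.
case: (@arg_minnP _ (Ordinal K1K) (fun k => ~~ (1 <= w k j t)) (fun k => k : nat) ncl)
  => k nck kmin.
rewrite (bigD1 k)//= (outstandingE fr) (completed_beforeS fr) nck ajt/=.
suff -> : completed_before r k j t by rewrite lerDl sumr_ge0.
have [k_eq0|k_gt0] := posnP k; first by rewrite k_eq0 completed_before0.
have k1K : (k.-1 < K)%N by rewrite (leq_ltn_trans (leq_pred k)).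
rewrite (@completed_beforeE _ _ _ _ _ fr k (Ordinal k1K)) /= ?prednK//.
apply: contraT => /kmin/=; lia.
Qed.

(** * Power and speed of the active servers *)

Lemma sum_speed t : Pinv 1 * ((0 < queue a r k0 t)%N%:R + (nactive a r t)%:R) <=
  \sum_(k < K) speed r k t.
Proof.
rewrite -sum_active mulr_sumr; apply: ler_sum => k _.
rewrite online_speedE; case: ifP => _; last by rewrite mulr0.
by rewrite mulr1 (Pinv_le pf) ?common_power_ge1.
Qed.

Lemma sum_power t : \sum_(k < K) P (speed r k t) =
  common_power t * ((0 < queue a r k0 t)%N%:R + (nactive a r t)%:R).
Proof.
rewrite -sum_active mulr_sumr; apply: eq_bigr => k _.
rewrite online_speedE; case: ifP => _; last by rewrite mulr0 (power0 pf).
by rewrite mulr1 (pf_invK pf)// (le_trans ler01)// common_power_ge1.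
Qed.

(** Write [q] for the first queue and [A] for the number of other active servers. If [q > 0], the
    [A + 1] active servers use power [q + A + 1] in total, and at most [q + A] jobs are present. If
    [q = 0], the power is [2 A] and at most [A] jobs are present. The number of active servers is
    then bounded through their speeds, each at least [Pinv 1]. *)
Lemma online_cost_rate t : @cost_rate R K n P a r t <=
  2 * (queue a r k0 t)%:R + 3 / Pinv 1 * \sum_(k < K) speed r k t.
Proof.
have s1 := Pinv_gt0 pf (@ltr01 R).
apply: (@le_trans _ _ (2 * (queue a r k0 t)%:R +
    3 * ((0 < queue a r k0 t)%N%:R + (nactive a r t)%:R))); last first.
  rewrite lerD2l -mulrA ler_pM2l// mulrC ler_pdivlMr// mulrC; exact: sum_speed.
rewrite /cost_rate sum_power /common_power; have := njobs_le t.
have [->|q_gt0] := posnP (queue a r k0 t).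
  by rewrite add0r mulr0 !add0r; lra.
have A0 : (nactive a r t)%:R >= 0 :> R by [].
rewrite !natrD [1%:R + _]addrC (mulfVK (lt0r_neq0 _)); lra.
Qed.

Lemma server1_speed t : (0 < queue a r k0 t)%N ->
  Pinv (1 + (queue a r k0 t)%:R / K%:R) <= speed r k0 t.
Proof.
move=> q_gt0; rewrite online_speedE q_gt0; apply: (Pinv_le pf).
  by rewrite addr_ge0// divr_ge0.
(* Server [k0] is not counted by [nactive]. *)
have AK : (nactive a r t + 1 <= K)%N.
  rewrite /nactive addn1 -[X in (_ < X)%N]card_ord -cardsT; apply: proper_card.
  by apply/properP; split; [exact/fintype.subsetP|exists k0; rewrite ?inE].
have A_gt0 : 0 < (nactive a r t + 1)%:R :> R by rewrite ltr0n addn1.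
rewrite /common_power q_gt0 -addnA natrD mulrDl divff ?lt0r_neq0// [leRHS]addrC lerD2l.
rewrite ler_wpM2l// lef_pV2 ?posrE //; last by rewrite ltr0n.
by rewrite ler_nat.
Qed.

End Online.

(** * The potential argument *)

(** The convex function with slope [c j] on []j, j+1]] for [j <= N], written as a sum of hinges;
    [c j] is a subgradient at [x], and this is checked hinge by hinge. The bound [x <= N] ensures
    that every hinge to the left of [x] is in the finite sum. *)
Lemma piecewise_linear_potential {R : realType} (c : nat -> R) (N : nat) :
  c 0%N = 0 -> {homo c : i j / (i <= j)%N >-> i <= j} ->
  exists Phi : R -> R, [/\ forall x, 0 <= Phi x, Phi 0 = 0 &
    forall x, x <= N%:R -> exists j : nat,
      [/\ x <= j.+1%:R, (0 < j)%N -> j%:R < x &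
          forall y, Phi x + c j * (y - x) <= Phi y]].
Proof.
move=> c0 c_nd.
have d_ge0 i : 0 <= c i.+1 - c i by rewrite subr_ge0 c_nd.
exists (fun x => \sum_(i < N) (c i.+1 - c i) * Num.max 0 (x - i.+1%:R)); split.
- by move=> x; apply: sumr_ge0 => i _; rewrite mulr_ge0// le_max lexx.
- by rewrite big1// => i _; rewrite sub0r max_l ?mulr0// oppr_le0.
move=> x xN.
have exj : exists j : nat, x <= j.+1%:R.
  by exists N; rewrite (le_trans xN)// ler_nat.
case: (ex_minnP exj) => j xj jmin; exists j.
have j_lt m : (m < j)%N -> m.+1%:R < x.
  by move=> mj; rewrite ltNge; apply/negP => /jmin; rewrite leqNgt mj.
have jN : (j <= N)%N by apply: jmin; rewrite (le_trans xN)// ler_nat.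
split=> // [|y]; first by case: j {xj jmin jN} j_lt => // j /(_ j (ltnSn j)).
have -> : c j = \sum_(i < N | (i < j)%N) (c i.+1 - c i).
  rewrite -(big_ord_widen _ (fun i => c i.+1 - c i) jN).
  by rewrite -(big_mkord xpredT (fun i => c i.+1 - c i)) telescope_sumr// c0 subr0.
rewrite mulr_suml [X in _ + X]big_mkcond -big_split/=; apply: ler_sum => i _.
case: ifPn => [/j_lt ij|]; last first.
  rewrite -leqNgt => ji; rewrite addr0 max_l ?mulr0 ?mulr_ge0 ?le_max ?lexx//.
  by rewrite subr_le0 (le_trans xj)// ler_nat ltnS.
rewrite max_r ?subr_ge0 ?(ltW ij)// -mulrDr ler_wpM2l//.
by rewrite le_max; apply/orP; right; lra.
Qed.

Section Potential.
Context {R : realType} {K n : nat} {P Pinv : R -> R} {a : 'I_n -> R}.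
Context {r r' : schedule R K n}.
Hypotheses (pf : power_function P Pinv) (K_gt0 : (0 < K)%N).
Hypotheses (onl : online a Pinv r) (fr' : feasible a r').
Local Notation mu := (@lebesgue_measure R).
Let fr := on_feasible onl.
Implicit Types (k i : 'I_K) (j : 'I_n) (t u : R).
Local Notation k0 := (Ordinal K_gt0).
Local Notation s1 := (Pinv 1).

Let S t : R := cumul (speed r k0) t.
Let total t : R := \sum_(k < K) speed r' k t.
Let W t : R := cumul total t.
(* [D] is the lag of server 1 behind the work of [r'], averaged over the servers. *)
Let D t : R := W t / K%:R - S t.
Let q t : R := (queue a r k0 t)%:R.
Let arrivals t : R := \sum_(j < n) (a j <= t)%R%:R.

Let K0 : 0 < K%:R :> R. Proof. by rewrite ltr0n. Qed.
Let K1 : 1 <= K%:R :> R. Proof. by rewrite ler1n. Qed.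
Let s1_gt0 : 0 < s1. Proof. exact: (Pinv_gt0 pf ltr01). Qed.

Let total_integrable : nn_integrable total.
Proof. by apply: nn_integrable_sum => k; exact: (speed_integrable fr'). Qed.

Let WE t : W t = \sum_(k < K) \sum_(j < n) cumul (r' k j) t.
Proof.
rewrite /W cumul_sum; last by move=> k; exact: (speed_integrable fr').
by apply: eq_bigr => k _; rewrite (cumul_speed fr').
Qed.

Let queue_completions t : q t + (completions (r := r) k0 t)%:R = arrivals t.
Proof.
rewrite /q queueE /completions natr_sum -big_split/=; apply: eq_bigr => j _.
rewrite (outstandingE fr) completed_before0 andbT (completed_beforeS fr).
case: (boolP (1 <= _)) => [w1|_]; last by rewrite andbT addr0.
by rewrite andbF add0r (work_arrived fr (k := k0) (lt_le_trans ltr01 w1)).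
Qed.

Let opt_work_arrivals t : W t / K%:R <= arrivals t.
Proof.
rewrite ler_pdivrMr// WE exchange_big/= mulr_suml; apply: ler_sum => j _.
apply: (@le_trans _ _ (\sum_(k < K) (a j <= t)%R%:R)); last first.
  by rewrite sumr_const card_ord mulr_natr.
apply: ler_sum => k _; case: (boolP (a j <= t)) => [_|ajt].
  exact: (work_le1 fr').
by rewrite leNgt; apply: contra ajt; exact: (work_arrived fr').
Qed.

(** An arrived job is either in the system of [r'] or has received all its [K] units of work
    there. *)
Let arrivals_le_njobs t : arrivals t <= (njobs a r' t)%:R + W t / K%:R.
Proof.
rewrite WE exchange_big/= mulr_suml njobsE -big_split/=; apply: ler_sum => j _.
have w0 : 0 <= (\sum_(k < K) cumul (r' k j) t) / K%:R.
  by rewrite divr_ge0// sumr_ge0// => k _; exact: (work_ge0 fr').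
case: (a j <= t); last by rewrite /= add0r.
case: (boolP (completed_before r' K j t)) => cK /=; last by rewrite lerDl.
rewrite add0r ler_pdivlMr// mul1r.
apply: (@le_trans _ _ (\sum_(k < K) 1)); first by rewrite sumr_const card_ord.
by apply: ler_sum => k _; exact: (completed_all fr').
Qed.

Let D_le_q t : D t <= q t.
Proof.
have := opt_work_arrivals t; have := completions_le onl k0 t.
have := queue_completions t; rewrite /D /S; lra.
Qed.

(** The summand 1 accounts for the partially processed job at the first server. *)
Let q_le t : q t <= (njobs a r' t)%:R + D t + 1.
Proof.
have := arrivals_le_njobs t; have := completions_gt onl k0 t.
have := queue_completions t; rewrite /D /S; lra.
Qed.

Let D_le_n t : D t <= n%:R.
Proof.
apply: (le_trans (D_le_q t)); apply: (@le_trans _ _ (arrivals t)).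
  by rewrite -queue_completions lerDl.
apply: (@le_trans _ _ (\sum_(j < n) 1)); last by rewrite sumr_const card_ord.
by apply: ler_sum => j _; rewrite lern1; case: (_ <= _).
Qed.

Let q_gt0_speed t : 0 < q t -> Pinv (1 + q t / K%:R) <= speed r k0 t.
Proof. by rewrite /q ltr0n; exact: (server1_speed pf onl). Qed.

Let q_gt0_speed1 t : 0 < q t -> s1 <= speed r k0 t.
Proof.
move=> q0; apply: le_trans (q_gt0_speed q0); apply: (Pinv_le pf) => //.
by rewrite lerDl divr_ge0// ltW.
Qed.

(** While [q > 0] the first server runs at speed at least [s1], and [q] never exceeds [n]; hence [q]
    is dominated by a multiple of an integrable speed. *)
Let q_integrable : nn_integrable q.
Proof.
have nk := speed_integrable fr k0.
split => //; first exact: (measurable_queue fr).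
have nn : nn_integrable (fun t => n%:R / s1 * speed r k0 t).
  by apply: nn_integrableZ => //; rewrite divr_ge0// ltW.
apply: le_lt_trans (nni_fin nn); apply: ge0_le_integral => //.
- by move=> t _; rewrite lee_fin.
- by apply/measurable_EFinP; exact: (measurable_queue fr).
- exact: nni_measurable_EFin.
move=> t _; rewrite lee_fin.
have q0 : 0 <= q t by [].
move: q0; rewrite le_eqVlt => /predU1P[<-|q0].
  by rewrite mulr_ge0 ?(speed_ge0 fr)// divr_ge0// ltW.
rewrite mulrAC ler_pdivlMr//; apply: ler_pM => //; [exact: ltW| |exact: q_gt0_speed1].
by rewrite /q ler_nat (leq_trans (max_card _))// card_ord.
Qed.

(** The marginal power at the speed of power [m / K]. The value 0 at [m = 0] makes the potential
    vanish for lags up to 1 and avoids the derivative of [P] at speed 0. *)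
Let slope (m : nat) : R := if m == 0%N then 0 else derive1 P (Pinv (m%:R / K%:R)).

Let level_gt0 m : 0 < m.+1%:R / K%:R :> R.
Proof. by rewrite divr_gt0. Qed.

Let slope_ge0 m : 0 <= slope m.
Proof.
case: m => [|m]; rewrite /slope//=; apply: ltW; apply: (derive_power_gt0 pf).
by apply: (Pinv_gt0 pf); exact: level_gt0.
Qed.

Let slope_nd : {homo slope : i j / (i <= j)%N >-> i <= j}.
Proof.
case=> [m _|i [//|m]]; [exact: slope_ge0|rewrite ltnS => im].
apply: (derive_power_le pf); first exact/(Pinv_gt0 pf)/level_gt0.
apply: (Pinv_le pf); first exact/ltW/level_gt0.
by rewrite ler_pM2r ?invr_gt0// ler_nat.
Qed.

Let budget t : R := @cost_rate R K n P a r' t + 3 / s1 * speed r k0 t.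

Let three_le t : 0 < q t -> 3 <= 3 / s1 * speed r k0 t.
Proof.
move=> q0; rewrite mulrAC ler_pdivlMr// ler_pM2l//; exact: q_gt0_speed1.
Qed.

(* The tangent of [P] at the speed of power [m%:R / K%:R], a speed which server 1
   of the online algorithm exceeds. *)
Let drift m t v : D t <= m.+1%:R -> ((0 < m)%N -> m%:R < D t) ->
    -1 <= D t - D v <= 1 ->
  q v + slope m * total v <= budget v + slope m * K%:R * speed r k0 v.
Proof.
move=> Dm mD /andP[Dv1 Dv2]; rewrite /budget /cost_rate.
have P0 k : 0 <= P (speed r' k v) by rewrite (pf_ge0 pf)// (speed_ge0 fr').
have sP0 : 0 <= \sum_(k < K) P (speed r' k v) by exact: sumr_ge0.
have s0 := speed_ge0 fr k0 v.
have s30 : 0 <= 3 / s1 * speed r k0 v by rewrite mulr_ge0// divr_ge0// ltW.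
have N0 : 0 <= (njobs a r' v)%:R :> R by [].
have qv := q_le v.
case: m Dm mD => [D1 _|m Dm /(_ isT) mD].
  rewrite /slope/= !mul0r.
  have : 0 <= q v by [].
  rewrite le_eqVlt => /predU1P[<-|/three_le]; lra.
have Dq := D_le_q v.
rewrite -natr1 in mD; rewrite -!natr1 in Dm.
have m0 : 0 <= m%:R :> R by [].
have q0 : 0 < q v by lra.
have s3 := three_le q0.
pose y : R := m.+1%:R / K%:R; pose s := Pinv y.
have y0 : 0 < y by exact: level_gt0.
have sv : s <= speed r k0 v.
  apply: le_trans (q_gt0_speed q0); apply: (Pinv_le pf); first exact: ltW.
  rewrite /y ler_pdivrMr// mulrDl mul1r mulfVK ?gt_eqF// -natr1; move: K1; lra.
have tangent : \sum_(k < K) (y + slope m.+1 * (speed r' k v - s)) <=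
    \sum_(k < K) P (speed r' k v).
  apply: ler_sum => k _; rewrite -(pf_invK pf (ltW y0)).
  by apply: (power_tangent pf); [exact: (Pinv_gt0 pf)|exact: (speed_ge0 fr')].
rewrite big_split/= sumr_const card_ord -mulr_sumr sumrB sumr_const card_ord -/(total v) in tangent.
rewrite -(mulr_natr y) -(mulr_natr s) {1}/y mulfVK ?gt_eqF// -natr1 in tangent.
have : slope m.+1 * (s * K%:R) <= slope m.+1 * K%:R * speed r k0 v.
  by rewrite -mulrA ler_wpM2l// mulrC ler_pM2l.
lra.
Qed.

Let budget_integrable : (cost P a r' < +oo)%E -> nn_integrable budget.
Proof.
move=> cfin; apply: nn_integrableD.
  split; [exact: (measurable_cost_rate pf fr')|exact: (cost_rate_ge0 pf fr')|].
  by rewrite -(costE pf fr').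
apply: nn_integrableZ; last exact: (speed_integrable fr).
by rewrite divr_ge0// ltW.
Qed.

Let queue_potential : (cost P a r' < +oo)%E -> forall t, cumul q t <= cumul budget t.
Proof.
move=> /budget_integrable nb.
have [Phi [Phi_ge0 Phi0 Phi_sub]] := piecewise_linear_potential n (erefl : slope 0 = 0) slope_nd.
have nS := speed_integrable fr k0; have nW := total_integrable.
(* Induction on the amount of work done keeps [D] within 1 of its final value on
   every step, which replaces a derivative of the potential along [D]. *)
suff key (M : nat) t : S t + W t / K%:R <= M%:R ->
    cumul q t + K%:R * Phi (D t) <= cumul budget t.
  move=> t; have [M tM] : exists M : nat, S t + W t / K%:R <= M%:R.
    by exists (Num.bound `|S t + W t / K%:R|); rewrite (le_trans (ler_norm _))// ltW// archi_boundP.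
  by have := key M t tM; have := mulr_ge0 (ltW K0) (Phi_ge0 (D t)); lra.
have S0 u : 0 <= S u by exact: cumul_ge0.
have W0 u : 0 <= W u / K%:R by apply: divr_ge0; [exact: (cumul_ge0 nW)|exact: ltW].
have Sle u v : u <= v -> S u <= S v by exact: cumul_le.
have Wle u v : u <= v -> W u / K%:R <= W v / K%:R.
  by move=> uv; rewrite ler_pM2r ?invr_gt0//; exact: cumul_le.
elim: M t => [|M IH] t tM.
  (* No work has been done up to [t], so the lag is 0 there and the drift bound with slope 0 reads
     [q <= budget]. *)
  have D0 v : v <= t -> D v = 0.
    by move=> vt; move: (Sle v t vt) (Wle v t vt) (S0 v) (W0 v); rewrite /D; lra.
  rewrite D0// Phi0 mulr0 addr0; apply: cumul_mono => // v vt.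
  have := @drift 0 v v; rewrite /slope/= !mul0r !addr0 subrr D0//.
  by apply=> //; apply/andP; split; lra.
have [/IH//|Mt] := leP (S t + W t / K%:R) M%:R.
(* The total [S + W / K] is continuous and starts at 0, so it takes the value [M] exactly. *)
have [u ut uM] : exists2 u, u <= t & S u + W u / K%:R = M%:R.
  pose f v := speed r k0 v + K%:R^-1 * total v.
  have nKW : nn_integrable (fun v => K%:R^-1 * total v).
    by apply: nn_integrableZ; rewrite ?invr_ge0.
  have nf : nn_integrable f by exact: nn_integrableD.
  have fE v : cumul f v = S v + W v / K%:R.
    by rewrite cumulD// cumulZ ?invr_ge0// mulrC.
  have [t1 t1t w1] := before_arrivals fr t.
  have [t2 t2t w2] := before_arrivals fr' t.
  have S1 : S t1 = 0 by rewrite /S (cumul_speed fr) big1.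
  have W2 : W t2 = 0 by rewrite WE big1// => k _; rewrite big1.
  pose t0 := Num.min t1 t2.
  have t01 : t0 <= t1 by rewrite ge_min lexx.
  have t02 : t0 <= t2 by rewrite ge_min lexx orbT.
  have [|v /andP[_ vt] <-] := cumul_IVT nf (le_trans t01 t1t) (x := M%:R).
    rewrite !fE (ltW Mt) andbT.
    have := Sle _ _ t01; have := Wle _ _ t02; rewrite S1 W2 mul0r => h1 h2.
    by have : 0 <= M%:R :> R by []; lra.
  by exists v.
(* The subgradient at the endpoint [D t] provides a single slope for the whole interval from [u] to
   [t]. *)
have [m [Dm mD sub]] := Phi_sub (D t) (D_le_n t).
have {}IH : cumul q u + K%:R * Phi (D u) <= cumul budget u by apply: IH; rewrite uM.
have sub_u := sub (D u).
have nqt : nn_integrable (fun v => slope m * total v) by exact: nn_integrableZ.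
have nbt : nn_integrable (fun v => slope m * K%:R * speed r k0 v).
  by apply: nn_integrableZ; rewrite ?mulr_ge0// ltW.
have : cumul (fun v => q v + slope m * total v) t -
       cumul (fun v => q v + slope m * total v) u <=
       cumul (fun v => budget v + slope m * K%:R * speed r k0 v) t -
       cumul (fun v => budget v + slope m * K%:R * speed r k0 v) u.
  apply: cumul_ler => //; [exact: nn_integrableD|exact: nn_integrableD|].
  (* [S + W / K] grows by at most 1 between [u] and [t], hence so does the variation of [D]. *)
  move=> v /andP[/ltW uv vt]; apply: (@drift m t) => //; rewrite -natr1 in tM.
  move: (Sle _ _ uv) (Sle _ _ vt) (Wle _ _ uv) (Wle _ _ vt); rewrite /D => ? ? ? ?.
  by apply/andP; split; lra.
have slopeK_ge0 : 0 <= slope m * K%:R by rewrite mulr_ge0// ltW.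
rewrite !(cumulD _ q_integrable nqt) !(cumulD _ nb nbt).
rewrite !(cumulZ _ (slope_ge0 m) nW) !(cumulZ _ slopeK_ge0 nS) => step.
have : K%:R * (Phi (D t) + slope m * (D u - D t)) <= K%:R * Phi (D u).
  by rewrite ler_pM2l.
(* By the definition of [D], the change of the linearised potential is exactly the difference of the
   two slope terms in the drift bound. *)
have -> : K%:R * (Phi (D t) + slope m * (D u - D t)) = K%:R * Phi (D t) +
    slope m * (W u - W t) - slope m * K%:R * (S u - S t).
  by rewrite /D; field; rewrite gt_eqF.
move: IH step; rewrite /W /S; lra.
Qed.

Lemma queue_integral_le : (\int[mu]_t ((queue a r k0 t)%:R)%:E <=
  cost P a r' + (3 / s1)%:E * \int[mu]_t (speed r k0 t)%:E)%E.
Proof.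
have [cinf|] := eqVneq (cost P a r') +oo%E.
  rewrite cinf addye ?leey// gt_eqF// (lt_le_trans (ltNyr 0))// mule_ge0//.
    by rewrite lee_fin divr_ge0// ltW.
  by apply: integral_ge0 => t _; rewrite lee_fin (speed_ge0 fr).
rewrite -ltey => cfin; have nb := budget_integrable cfin.
apply: (@le_trans _ _ (\int[mu]_t (budget t)%:E)%E).
  apply: ge0_integral_le_upto => //; first exact: (measurable_queue fr).
  move=> t; have := queue_potential cfin t; rewrite -lee_fin -!cumulE// => /le_trans; apply.
  apply: ge0_subset_integral => //; first exact: nni_measurable_EFin.
  by move=> v _; rewrite lee_fin (nni_ge0 nb).
rewrite (costE pf fr'); under eq_integral do rewrite EFinD.
have nS := speed_integrable fr k0.
rewrite ge0_integralD//.
- rewrite leeD2l//; under eq_integral do rewrite EFinM.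
  rewrite ge0_integralZl_EFin//.
  + by move=> t _; rewrite lee_fin (speed_ge0 fr).
  + exact: nni_measurable_EFin.
  + by rewrite divr_ge0// ltW.
- by move=> t _; rewrite lee_fin (cost_rate_ge0 pf fr').
- by apply/measurable_EFinP; exact: (measurable_cost_rate pf fr').
- by move=> t _; rewrite lee_fin mulr_ge0 ?(speed_ge0 fr)// divr_ge0// ltW.
- apply: nni_measurable_EFin; apply: nn_integrableZ => //.
  by rewrite divr_ge0// ltW.
Qed.

End Potential.

(** * The competitive ratio *)

Section Competitive.
Context {R : realType} {K n : nat} {P Pinv : R -> R} {a : 'I_n -> R}.
Context {r : schedule R K n}.
Hypotheses (pf : power_function P Pinv) (K_gt0 : (0 < K)%N) (onl : online a Pinv r).
Local Notation mu := (@lebesgue_measure R).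
Local Notation s1 := (Pinv 1).
Let fr := on_feasible onl.
Let s1_gt0 : 0 < s1. Proof. exact: (Pinv_gt0 pf ltr01). Qed.

Lemma speed_integral_le k : (\int[mu]_t (speed r k t)%:E <= n%:R%:E)%E.
Proof.
have nS := speed_integrable fr k.
apply: ge0_integral_le_upto => [|t|t]; [exact: nni_measurable|exact: (nni_ge0 nS)|].
by rewrite cumulE// lee_fin; exact: (cumul_speed_le fr).
Qed.

Lemma online_cost_le (r' : schedule R K n) : feasible a r' ->
  (cost P a r <= 2%:E * cost P a r' + (9 / s1 * (n%:R * K%:R))%:E)%E.
Proof.
move=> fr'; have mS k := speed_integrable fr k.
have s1V : 0 <= 3 / s1 by rewrite divr_ge0// ltW.
have nT : nn_integrable (fun t => \sum_(k < K) speed r k t) by exact: nn_integrable_sum.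
have mq := measurable_queue fr (Ordinal K_gt0).
have sumS : (\int[mu]_t (\sum_(k < K) speed r k t)%:E <= (n%:R * K%:R)%:E)%E.
  apply: ge0_integral_le_upto => [|t|t]; [exact: nni_measurable|exact: (nni_ge0 nT)|].
  rewrite cumulE// lee_fin cumul_sum//.
  rewrite mulr_natr -[X in _ *+ X]card_ord -sumr_const; apply: ler_sum => k _.
  exact: (cumul_speed_le fr).
have cost_ge0 : (0 <= cost P a r')%E.
  rewrite (costE pf fr'); apply: integral_ge0 => t _.
  by rewrite lee_fin (cost_rate_ge0 pf fr').
(* The 9 is [2 * 3 + 3]: twice the error of the queue bound, plus the cost of the active servers. *)
have -> : (2%:E * cost P a r' + (9 / s1 * (n%:R * K%:R))%:E =
    2%:E * (cost P a r' + (3 / s1)%:E * (n%:R * K%:R)%:E) +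
    (3 / s1)%:E * (n%:R * K%:R)%:E)%E.
  move: (cost P a r') cost_ge0 => c c0.
  have c1 : 0 <= 3 / s1 * (n%:R * K%:R) by rewrite mulr_ge0// mulr_ge0.
  rewrite -!EFinM ge0_muleDr ?lee_fin// -addeA -EFinM -EFinD.
  by congr (_ + _%:E)%E; ring.
apply: (@le_trans _ _ (2%:E * (\int[mu]_t ((queue a r (Ordinal K_gt0) t)%:R)%:E) +
    (3 / s1)%:E * \int[mu]_t (\sum_(k < K) speed r k t)%:E)%E).
  rewrite (costE pf fr) -(integralZ_ge0 _ mq)//.
  rewrite -(integralZ_ge0 s1V (nni_measurable nT) (nni_ge0 nT)).
  have nZ := nn_integrableZ s1V nT.
  have m2q : measurable_fun setT (fun t => 2 * (queue a r (Ordinal K_gt0) t)%:R : R).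
    by apply: measurable_funM => //; exact: measurable_cst.
  rewrite -(integralD_ge0 m2q _ (nni_measurable nZ) (nni_ge0 nZ)); last first.
    by move=> t; rewrite mulr_ge0.
  apply: integral_le_ge0 => [| |t|t].
  - exact: (measurable_cost_rate pf fr).
  - by apply: measurable_funD => //; exact: nni_measurable.
  - exact: (cost_rate_ge0 pf fr).
  - exact: (online_cost_rate pf K_gt0 onl).
apply: leeD; last by rewrite lee_wpmul2l ?lee_fin.
rewrite lee_wpmul2l ?lee_fin//.
apply: le_trans (queue_integral_le pf K_gt0 onl fr') _; rewrite leeD2l//.
rewrite lee_wpmul2l ?lee_fin//; apply: le_trans (speed_integral_le _) _.
by rewrite lee_fin ler_peMr// ler1n.
Qed.

(** Against any competitor, the additive term [9 n K / s1] becomes multiplicative: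
    [1 / s1 <= Delta P Pinv 1], and [n K] is at most its cost divided by the derivative at [s]. This
    yields the factor [2 + 9 Delta / P'(s)], which is below the stated one. *)
Lemma online_cost_le_opt (s : R) : 0 < s -> 1 + P s = s * derive1 P s ->
  (cost P a r <=
    (6 + 12 / derive1 P s * Delta P Pinv 1)%:E * opt_cost K P a)%E.
Proof.
move=> s_gt0 sP; set C : R := 6 + _.
have dP := derive_power_gt0 pf s_gt0.
have dP1 : 0 < Delta P Pinv 1 by exact: (derive_power_gt0 pf).
have C_gt0 : 0 < C by rewrite addr_gt0// mulr_gt0// divr_gt0.
(* This is [P s1 <= s1 * P'(s1)] with [P s1 = 1]. *)
have s1_Delta : s1^-1 <= Delta P Pinv 1.
  rewrite -[leLHS]mul1r ler_pdivrMr// mulrC -{1}(pf_invK pf (@ler01 R)).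
  exact: (derive_power_ge pf).
have CV : 0 < C^-1 by rewrite invr_gt0.
(* Dividing by [C] isolates the infimum, so each feasible schedule can be treated separately. *)
suff : ((C^-1)%:E * cost P a r <= opt_cost K P a)%E.
  rewrite -(@lee_pmul2l _ C%:E)// ?lte_fin//.
  by rewrite muleA -EFinM divff ?gt_eqF// mul1e.
apply: le_ereal_inf_tmp => _ [r' /= fr' <-].
rewrite -(@lee_pmul2l _ C%:E)// ?lte_fin//.
rewrite muleA -EFinM divff ?gt_eqF// mul1e.
apply: le_trans (online_cost_le fr') _.
have := cost_lower_bound pf fr' s_gt0 sP.
case: (cost P a r') => [x||]; last by [].
- rewrite -!EFinM -EFinD !lee_fin => lb.
  have x0 : 0 <= x by apply: le_trans lb; rewrite !mulr_ge0// ltW.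
  have nK : n%:R * K%:R <= x / derive1 P s by rewrite ler_pdivlMr.
  have : 9 / s1 * (n%:R * K%:R) <= 9 * Delta P Pinv 1 * (x / derive1 P s).
    by apply: ler_pM; rewrite ?mulr_ge0 ?invr_ge0 ?(ltW s1_gt0)// ler_pM2l.
  have -> : C * x = 6 * x + 12 * Delta P Pinv 1 * (x / derive1 P s).
    by rewrite /C; ring.
  have : 0 <= Delta P Pinv 1 * (x / derive1 P s).
    by rewrite mulr_ge0 ?divr_ge0// ltW.
  lra.
- by move=> _; rewrite [leRHS]gt0_muley ?lte_fin// leey.
Qed.

End Competitive.

Lemma opt_cost_gt0 {R : realType} {K n : nat} {P Pinv : R -> R} (a : 'I_n -> R) (s : R) :
  power_function P Pinv -> 0 < s -> 1 + P s = s * derive1 P s ->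
  (0 < K)%N -> (0 < n)%N -> (0 < opt_cost K P a)%E.
Proof.
move=> pf s_gt0 sP K_gt0 n_gt0.
apply: (@lt_le_trans _ _ (n%:R * K%:R * derive1 P s)%:E).
  by rewrite lte_fin !mulr_gt0 ?ltr0n// (derive_power_gt0 pf).
by apply: le_ereal_inf_tmp => _ [r' fr' <-]; exact: (cost_lower_bound pf fr').
Qed.

(** * Power laws *)

Section PowerLaw.
Context {R : realType} {P Pinv : R -> R} (pf : power_function P Pinv) (alpha : R).
Hypothesis P_powR : forall s : R, 0 <= s -> P s = s `^ alpha.

Lemma powR_Pinv1 : Pinv 1 = 1.
Proof.
have P1 : P 1 = 1 by rewrite P_powR// powR1.
by rewrite -[in LHS]P1 (powerK pf).
Qed.

Lemma powR_Delta : Delta P Pinv 1 = alpha.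
Proof.
(* [P] is a power only on nonnegative speeds, which suffices because a derivative at 1 depends on
   values near 1. *)
rewrite /Delta powR_Pinv1 derive1E (@near_eq_derive _ _ _ P (fun x => x `^ alpha)).
  have [_ ->] := @is_derive1_powR R alpha 1 ltr01.
  by rewrite powR1 mulr1.
near=> x; apply: P_powR; near: x.
by exists 1 => //= x /=; rewrite ltr_norml; lra.
Unshelve. all: by end_near. Qed.

End PowerLaw.

Theorem theorem1 (R : realType) (K : nat) (K_gt0 : (0 < K)%N)
    (P Pinv : R -> R) (P_power : power_function P Pinv) :
  [/\ (forall sstar : R, 0 < sstar -> 1 + P sstar = sstar * derive1 P sstar ->
        forall (n : nat) (a : 'I_n -> R) (r : schedule R K n),
          online a Pinv r ->
          (cost P a r <=
            (6 + 12 / derive1 P sstar * Delta P Pinv 1)%:E * opt_cost K P a)%E),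
      (forall alpha : R, (forall s : R, 0 <= s -> P s = s `^ alpha) ->
        Delta P Pinv 1 = alpha)
    & (forall s : R, 0 <= s -> P s = s ^+ 2) ->
        (competitive_ratio K P Pinv <= 18%:E)%E].
Proof.
split=> [s s_gt0 sP n a r onl|alpha|P_sqr].
- exact: (online_cost_le_opt P_power K_gt0 onl).
- exact: (powR_Delta P_power).
have P_powR2 s : 0 <= s -> P s = s `^ 2 by move=> s0; rewrite P_sqr// powR_mulrn.
have Delta2 := powR_Delta P_power P_powR2.
have dP2 : derive1 P 1 = 2 by rewrite -{1}(powR_Pinv1 P_power P_powR2).
(* For the square, [sstar = 1], and the factor is [6 + (12 / 2) * 2 = 18]. *)
have sP : 1 + P 1 = 1 * derive1 P 1 by rewrite dP2 P_sqr// expr1n mul1r.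
apply: ge_ereal_sup => _ [n [a [r [n_gt0 onl ->]]]].
have := online_cost_le_opt P_power K_gt0 onl ltr01 sP.
rewrite Delta2 dP2 (_ : 6 + 12 / 2 * 2 = 18 :> R); last by field.
have := opt_cost_gt0 a P_power ltr01 sP K_gt0 n_gt0.
(* If the optimal cost were infinite, the quotient would be 0, since the inverse of [+oo] is 0. *)
case: (opt_cost K P a) => [x|_ _|//]; last by rewrite invey mule0 lee_fin.
rewrite lte_fin => x_gt0 le18; rewrite inver gt_eqF//.
rewrite -(@lee_pmul2r _ x%:E)// ?lte_fin//.
by rewrite -muleA -EFinM mulVf ?gt_eqF// mule1.
Qed.
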